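(* Let $1\le k\le p$ and $0\le k^*\le k$ be integers, let $f_1,f_2:2^{\{1,\ldots,p\}}\to\mathbb{R}$ be the two score functions (depending on the matrix $\Sigma$) used by the algorithm SSPCA, let $\mathcal{I}^*\subseteq\{1,\ldots,p\}$ be the target set, $|\mathcal{I}^*|=k$, and let $\delta,\xi\in[0,1]$. Suppose that $\Sigma$ is $\xi$-separable with respect to $f_2$, and that there exists a seed $\mathcal{S}_0\subseteq\{1,\ldots,p\}$ of size $k^*$ such that GreedySPCA$(f_1,\mathcal{S}_0,k)$ outputs a set $\mathcal{I}_0$ satisfying $|\mathcal{I}_0\cap\mathcal{I}^*|\ge\delta k$. Then SSPCA$(f_1,f_2,k,k^* )$ outputs a set $\mathcal{I}$ satisfying $|\mathcal{I}\cap\mathcal{I}^*|\ge(\delta-\xi)k$.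
   Context: $\Sigma\in\mathbb{R}^{p\times p}$ is a symmetric matrix (the sample covariance matrix), and the set functions $f_1,f_2$ may be defined in terms of $\Sigma$. The set $\mathcal{I}^*$ of size $k$ is the support the algorithm tries to recover. GreedySPCA$(f,\mathcal{S}^*,k)$: the input is a function $f:2^{\{1,\ldots,p\}}\to\mathbb{R}$, a seed $\mathcal{S}^*\subseteq\{1,\ldots,p\}$ with $|\mathcal{S}^*|=k^*\le k$, and the solution size $k$. For each $i\in\{1,\ldots,p\}\setminus\mathcal{S}^*$ compute $a_i=f(\mathcal{S}^*\cup\{i\})$; sort these as $a_{i_1}\ge a_{i_2}\ge\dots\ge a_{i_{p-k^*}}$; output $\mathcal{S}^*\cup\{i_1,\ldots,i_{k-k^*}\}$. SSPCA$(f_1,f_2,k,k^* )$: for every seed $\mathcal{S}^*\subseteq\{1,\ldots,p\}$ of size $k^*$, let $\mathcal{S}^{(\mathcal{S}^* )}$ be the output of GreedySPCA$(f_1,\mathcal{S}^*,k)$. Output a set $\mathcal{S}^{(\mathcal{S}^* )}$ whose value $f_2(\mathcal{S}^{(\mathcal{S}^* )})$ is maximal over all seeds $\mathcal{S}^*$ of size $k^*$. $\Sigma$ is called $\xi$-separable with respect to $f_2$ if for every two sets $\mathcal{I},\mathcal{J}\subseteq\{1,\ldots,p\}$ of size $k$, $|\mathcal{I}\cap\mathcal{I}^*|-|\mathcal{J}\cap\mathcal{I}^*|\ge\xi k$ implies $f_2(\mathcal{I})>f_2(\mathcal{J})$. *)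

(* Defs.v *)
From mathcomp Require Import all_boot all_order all_algebra reals.

Set Implicit Arguments.
Unset Strict Implicit.
Unset Printing Implicit Defensive.

Import Order.TTheory GRing.Theory Num.Theory.
Local Open Scope ring_scope.

(* The index set {1, ..., p} is 'I_p. *)

(* [s] is the list i_1, i_2, ... of the indices outside the seed [S]; ties
   between equal scores may be sorted either way, so this is a relation. *)
Definition greedySPCA_output (R : realType) (p : nat)
    (f : {set 'I_p} -> R) (S : {set 'I_p}) (k : nat) (O : {set 'I_p}) : Prop :=
  exists s : seq 'I_p,
    [/\ perm_eq s (enum (~: S)),
        sorted (fun i j => f (S :|: [set i]) >= f (S :|: [set j])) s
      & O = S :|: [set i in take (k - #|S|)%N s]].

(* A deterministic GreedySPCA, with an arbitrary tie-breaking rule: the same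
   call always returns the same set. *)
Definition is_greedySPCA (R : realType) (p : nat)
    (greedy : ({set 'I_p} -> R) -> {set 'I_p} -> nat -> {set 'I_p}) : Prop :=
  forall (f : {set 'I_p} -> R) (S : {set 'I_p}) (k : nat),
    (#|S| <= k <= p)%N -> greedySPCA_output f S k (greedy f S k).

(* [I] is a possible output of SSPCA run on top of [greedy]; the maximizing
   seed need not be unique. *)
Definition SSPCA_output (R : realType) (p : nat)
    (greedy : ({set 'I_p} -> R) -> {set 'I_p} -> nat -> {set 'I_p})
    (f1 f2 : {set 'I_p} -> R) (k kstar : nat) (I : {set 'I_p}) : Prop :=
  exists S : {set 'I_p},
    [/\ #|S| = kstar,
        I = greedy f1 S k
      & forall S' : {set 'I_p}, #|S'| = kstar ->
          f2 (greedy f1 S' k) <= f2 (greedy f1 S k)].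

(* The score function is given as a function of the matrix and evaluated at
   [Sigma]. *)
Definition separable (R : realType) (p : nat) (xi : R) (k : nat)
    (Istar : {set 'I_p}) (f2 : 'M[R]_p -> {set 'I_p} -> R)
    (Sigma : 'M[R]_p) : Prop :=
  forall I J : {set 'I_p}, #|I| = k -> #|J| = k ->
    #|I :&: Istar|%:R - #|J :&: Istar|%:R >= xi * k%:R ->
    f2 Sigma I > f2 Sigma J.

(* Main.v *)
(* The greedy output I_0 of the good seed is itself a candidate of SSPCA. If the
   selected set I overlapped the target in fewer than (delta - xi) k indices,
   the overlap of I_0 would be larger by at least xi k, so separability would
   give f_2(I_0) > f_2(I), against the maximality of f_2(I). *)
Require Import Defs.
From mathcomp Require Import all_boot all_order all_algebra reals.
Import Order.TTheory GRing.Theory Num.Theory.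
Local Open Scope ring_scope.

(** Separability only compares sets of size exactly [k]. The selected indices are distinct and avoid
    [S], and since [k <= p] the list [s] is long enough for [take] to return all [k - #|S|] of
    them. *)
Lemma card_greedySPCA_output (R : realType) (p : nat)
    (f : {set 'I_p} -> R) (S : {set 'I_p}) (k : nat) (O : {set 'I_p}) :
  (#|S| <= k <= p)%N -> greedySPCA_output f S k O -> #|O| = k.
Proof.
move=> /andP[leSk lekp] [s [perm_s _ ->]].
have uniq_s : uniq s by rewrite (perm_uniq perm_s) enum_uniq.
have size_s : size s = (p - #|S|)%N.
  by rewrite (perm_size perm_s) -cardE (cardsCs (~: S)) setCK card_ord.
rewrite cardsU disjoint_setI0 ?cards0 ?subn0; last first.
  apply/pred0P => i /=; apply/andP => -[iS]; rewrite inE => /mem_take.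
  by rewrite (perm_mem perm_s) mem_enum inE iS.
rewrite cardsE (card_uniqP (take_uniq _ uniq_s)) size_takel ?subnKC //.
by rewrite size_s leq_sub2r.
Qed.

Theorem proposition4p1 (R : realType) (p k kstar : nat)
    (hk1 : (1 <= k)%N) (hkp : (k <= p)%N) (hkstar : (kstar <= k)%N)
    (Sigma : 'M[R]_p) (hSigma : Sigma^T = Sigma)
    (f1 f2 : 'M[R]_p -> {set 'I_p} -> R)
    (Istar : {set 'I_p}) (hIstar : #|Istar| = k)
    (delta xi : R) (hdelta : 0 <= delta <= 1) (hxi : 0 <= xi <= 1)
    (greedy : ({set 'I_p} -> R) -> {set 'I_p} -> nat -> {set 'I_p})
    (hgreedy : is_greedySPCA greedy)
    (hsep : separable xi k Istar f2 Sigma)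
    (hseed : exists S0 : {set 'I_p}, #|S0| = kstar /\
       #|greedy (f1 Sigma) S0 k :&: Istar|%:R >= delta * k%:R) :
  (exists I : {set 'I_p}, SSPCA_output greedy (f1 Sigma) (f2 Sigma) k kstar I) /\
  (forall I : {set 'I_p}, SSPCA_output greedy (f1 Sigma) (f2 Sigma) k kstar I ->
     #|I :&: Istar|%:R >= (delta - xi) * k%:R).
Proof.
have card_greedy (S : {set 'I_p}) : #|S| = kstar -> #|greedy (f1 Sigma) S k| = k.
  move=> cardS; have Sk : (#|S| <= k <= p)%N by rewrite cardS hkstar hkp.
  exact: card_greedySPCA_output Sk (hgreedy _ _ _ Sk).
have [S0 [cardS0 le_S0]] := hseed; split.
  (* An output exists: there are finitely many seeds of size [kstar], and [S0] is one, so the score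
     attains a maximum over them. *)
  have /eqP S0P := cardS0.
  case: (Order.TotalTheory.arg_maxP (P := fun S : {set 'I_p} => #|S| == kstar)
           (fun S => f2 Sigma (greedy (f1 Sigma) S k)) S0P) => S /eqP cardS maxS.
  by exists (greedy (f1 Sigma) S k), S; split=> // S' /eqP; exact: maxS.
move=> _ [S [cardS -> maxS]].
have [//|lt_S] := lerP ((delta - xi) * k%:R) _.
suff /lt_geF : f2 Sigma (greedy (f1 Sigma) S k)
               < f2 Sigma (greedy (f1 Sigma) S0 k) by rewrite maxS.
apply: hsep; rewrite ?card_greedy // lerBrDr addrC -lerBrDr.
(* The overlap for [S] is below [delta * k - xi * k], and [delta * k] is at most the overlap for
   [S0]. *)
by apply: le_trans (ltW lt_S) _; rewrite mulrBl lerB.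
Qed.
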